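(* Let $N\ge1$, $s\in(0,1)$, $p>1$ and $\mathbb{R}^N_+:=\{x\in \mathbb{R}^N: x_1>0\}$. Let $q\in L^{\infty}(\mathbb{R}^N_+)$, $q\geq 0$, and let $u\in \mathcal{W}^{s,p}_0(\mathbb{R}^N_+)\cap L^{\infty}(\mathbb{R}^N_+)$ be a nonnegative continuous function which satisfies in weak sense $$(-\Delta)^s_pu+q(x)|u|^{p-2}u=0\quad \text{ in } \mathbb{R}^N_+,\qquad \lim_{|x|\to \infty} u(x)=0.$$ Suppose that $q$ is increasing in the direction of $x_1$, i.e. $q(x+te_1)\geq q(x)$ for all $x\in \mathbb{R}^N_+$, $t\geq0$ (where $e_1$ is the first standard basis vector), and that one of the following holds: (1) $\frac{1}{1-s}<p\leq 2$, or (2) $p\geq 2$ and $u\in C^{\alpha}_{loc}(\mathbb{R}^N_+)$ for some $\alpha\in(0,1]$ with $\alpha(p-2)>sp-1$. Then $u\equiv 0$ on $\mathbb{R}^N$.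
   Context: $W^{s,p}(\mathbb{R}^N)$ is the set of $u\in L^p(\mathbb{R}^N)$ with $\int_{\mathbb{R}^N}\int_{\mathbb{R}^N}\frac{|u(x)-u(y)|^p}{|x-y|^{N+sp}}\,dx\,dy<\infty$. For an open set $D\subset\mathbb{R}^N$, $\mathcal{W}^{s,p}_0(D):=\{u\in W^{s,p}(\mathbb{R}^N): u= 0 \text{ a.e. on } \mathbb{R}^N\setminus D\}$. A function $u\in\mathcal{W}^{s,p}_0(D)$ satisfies $(-\Delta)^s_pu+q(x)|u|^{p-2}u=0$ in $D$ in weak sense if for all nonnegative $\varphi\in\mathcal{W}^{s,p}_0(D)$ with compact support in $\mathbb{R}^N$, $$\int_{\mathbb{R}^N}\int_{\mathbb{R}^N}\frac{|u(x)-u(y)|^{p-2}(u(x)-u(y))(\varphi(x)-\varphi(y))}{|x-y|^{N+sp}}\,dx\,dy+\int_D q|u|^{p-2}u\,\varphi\,dx=0 .$$ (Here $|a|^{p-2}a:=0$ for $a=0$.) $C^\alpha_{loc}(D)$ denotes the functions that are Hölder continuous with exponent $\alpha$ (Lipschitz if $\alpha=1$) on every compact subset of $D$. *)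

(* Defs.v *)
From HB Require Import structures.
From mathcomp Require Import all_boot all_order all_algebra.
From mathcomp Require Import all_classical all_reals all_analysis.

Set Implicit Arguments.
Unset Strict Implicit.
Unset Printing Implicit Defensive.

Import Order.TTheory GRing.Theory Num.Theory.
Import numFieldNormedType.Exports.

Local Open Scope classical_set_scope.
Local Open Scope ring_scope.

(* 'rV[R]_n carries the product Borel sigma-algebra, generated by the coordinate
   functions as the library does for tuples. *)
Section measurable_rV.
Context (R : realType) (n : nat).

Let coord (i : 'I_n) (x : 'rV[R]_n) : measurableTypeR R := x ord0 i.

Let rV_set0 : g_sigma_preimage coord set0.
Proof. exact: sigma_algebra0. Qed.

Let rV_setC A : g_sigma_preimage coord A -> g_sigma_preimage coord (~` A).
Proof. exact: sigma_algebraC. Qed.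

Let rV_bigcup (F : _^nat) : (forall i, g_sigma_preimage coord (F i)) ->
  g_sigma_preimage coord (\bigcup_i (F i)).
Proof. exact: sigma_algebra_bigcup. Qed.

HB.instance Definition _ := @isMeasurable.Build default_measure_display
  'rV[R]_n (g_sigma_preimage coord) rV_set0 rV_setC rV_bigcup.

Lemma measurable_coord (i : 'I_n) :
  measurable_fun setT (fun x : 'rV[R]_n => x ord0 i : measurableTypeR R).
Proof.
move=> _ Y mY; rewrite setTI; apply: sub_sigma_algebra => /=.
rewrite -bigcup_seq/=; exists i => /=; first by rewrite mem_index_enum.
by exists Y => //; rewrite setTI.
Qed.

Lemma measurable_fun_rVP d (T : measurableType d) (f : T -> 'rV[R]_n) :
  (forall i, measurable_fun setT (fun x => f x ord0 i : measurableTypeR R)) ->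
  measurable_fun setT f.
Proof.
move=> mf _ A mA; rewrite setTI.
suff : g_sigma_preimage (fun i => coord i \o f) `<=` measurable.
  by apply; rewrite g_sigma_preimage_comp; exists A => //; rewrite setTI.
apply: smallest_sub; first exact: sigma_algebra_measurable.
move=> B; rewrite -bigcup_seq/= => -[i _ [C mC <-]].
exact: mf.
Qed.

End measurable_rV.

Section cons_measure.
Context (R : realType) (n : nat).

Definition cons_rV (x : measurableTypeR R * 'rV[R]_n) : 'rV[R]_n.+1 :=
  \row_i (if unlift ord0 i is Some j then x.2 ord0 j else x.1).

Let uncons_rV (x : 'rV[R]_n.+1) : measurableTypeR R * 'rV[R]_n :=
  (x ord0 ord0, \row_i x ord0 (lift ord0 i)).

Lemma cons_rV0 x : cons_rV x ord0 ord0 = x.1.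
Proof. by rewrite mxE unlift_none. Qed.

Lemma cons_rVS x i : cons_rV x ord0 (lift ord0 i) = x.2 ord0 i.
Proof. by rewrite mxE liftK. Qed.

Let cons_rVK : cancel cons_rV uncons_rV.
Proof.
move=> [a v]; rewrite /uncons_rV cons_rV0; congr pair.
by apply/rowP => i; rewrite mxE cons_rVS.
Qed.

Lemma measurable_cons_rV : measurable_fun setT cons_rV.
Proof.
apply: measurable_fun_rVP => i.
case: (unliftP ord0 i) => [j ->|->].
  under eq_fun do rewrite cons_rVS.
  by apply: (measurableT_comp (@measurable_coord R n j)); exact: measurable_snd.
by under eq_fun do rewrite cons_rV0; exact: measurable_fst.
Qed.

HB.instance Definition _ := isMeasurableFun.Build _ _ _ _ cons_rV
  measurable_cons_rV.

Let measurable_uncons_rV : measurable_fun setT uncons_rV.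
Proof.
apply/measurable_fun_pairP; split; first exact: measurable_coord.
apply: measurable_fun_rVP => i /=.
by under eq_fun do rewrite mxE; exact: measurable_coord.
Qed.

Variable mu : {sigma_finite_measure set 'rV[R]_n -> \bar R}.

Definition cons_measure : set 'rV[R]_n.+1 -> \bar R :=
  pushforward (lebesgue_measure \x mu)%E cons_rV.

Let cons_measure0 : cons_measure set0 = 0%E.
Proof. by rewrite /cons_measure /pushforward preimage_set0 measure0. Qed.

Let cons_measure_ge0 A : (0 <= cons_measure A)%E.
Proof. exact: measure_ge0. Qed.

Let cons_measure_sigma_additive : semi_sigma_additive cons_measure.
Proof.
exact: measure_semi_sigma_additive.
Qed.

HB.instance Definition _ := isMeasure.Build _ _ _ cons_measure
  cons_measure0 cons_measure_ge0 cons_measure_sigma_additive.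

Let cons_measure_sigma_finite : sigma_finite setT cons_measure.
Proof.
have /sigma_finiteP[F [TF ndF Foo]] := sigma_finiteT (@lebesgue_measure R).
have /sigma_finiteP[G [TG ndG Goo]] := sigma_finiteT mu.
have mFG k : measurable (F k `*` G k).
  by have [? _] := Foo k; have [? _] := Goo k; exact: measurableX.
exists (fun k => uncons_rV @^-1` (F k `*` G k)).
  rewrite -preimage_bigcup -(preimage_setT uncons_rV); congr (_ @^-1` _).
  rewrite -setXTT TF TG predeqE => -[x y]; split.
    move=> [/= [k _ Fkx] [l _ Gly]]; exists (maxn k l) => //; split.
    - by move: x Fkx; exact/subsetPset/ndF/leq_maxl.
    - by move: y Gly; exact/subsetPset/ndG/leq_maxr.
  by move=> [k _ [/= Fkx Gky]]; split; exists k.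
move=> k; split.
  by rewrite -[X in measurable X]setTI; exact: measurable_uncons_rV.
rewrite /cons_measure /pushforward -comp_preimage.
rewrite (_ : uncons_rV \o cons_rV = id); last first.
  by apply/funext => x; exact: cons_rVK.
have [mF Fk] := Foo k; have [mG Gk] := Goo k.
by rewrite preimage_id product_measure1E// lte_mul_pinfty// ge0_fin_numE.
Qed.

HB.instance Definition _ := Measure_isSigmaFinite.Build _ _ _ cons_measure
  cons_measure_sigma_finite.

End cons_measure.

(* Lebesgue measure on R^n as the n-fold product of lebesgue_measure;
   lebesgue_rV_box computes it on boxes. *)
Fixpoint lebesgue_rV (R : realType) (n : nat) :
    {sigma_finite_measure set 'rV[R]_n -> \bar R} :=
  match n with
  | 0 => \d_(0 : 'rV[R]_0)
  | n'.+1 => cons_measure (lebesgue_rV R n')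
  end.

Lemma measurable_box (R : realType) (n : nat)
    (A : 'I_n -> set (measurableTypeR R)) :
  (forall i, measurable (A i)) ->
  measurable [set x : 'rV[R]_n | forall i, A i (x ord0 i)].
Proof.
move=> mA; rewrite [X in measurable X](_ : _ = \bigcap_(k in [set: nat])
    [set x : 'rV[R]_n | forall i : 'I_n, i = k :> nat -> A i (x ord0 i)]).
  apply: bigcapT_measurable => k.
  have [kn|nk] := ltnP k n; last first.
    rewrite [X in measurable X](_ : _ = setT)//; apply/seteqP; split => // x _ i ik.
    by move: (ltn_ord i); rewrite ik ltnNge nk.
  rewrite [X in measurable X](_ : _ = (fun x : 'rV[R]_n => x ord0 (Ordinal kn)) @^-1`
      A (Ordinal kn)).
    by rewrite -[X in measurable X]setTI; exact: measurable_coord.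
  apply/seteqP; split => x /=; first exact.
  by move=> xA i ik; rewrite (_ : i = Ordinal kn)//; exact/val_inj.
by apply/seteqP; split => [x xA k _ i _|x xA i]; [exact: xA|exact: (xA i)].
Qed.

Lemma lebesgue_rV_box (R : realType) (n : nat)
    (A : 'I_n -> set (measurableTypeR R)) :
  (forall i, measurable (A i)) ->
  lebesgue_rV R n [set x | forall i, A i (x ord0 i)] =
  (\prod_(i < n) lebesgue_measure (A i))%E.
Proof.
elim: n A => [|n IH] A mA.
  by rewrite big_ord0 /= diracE mem_set// => -[].
rewrite big_ord_recl /= /cons_measure /pushforward -IH; last by move=> i; exact: mA.
have mB : measurable
    [set x : 'rV[R]_n | forall i, A (lift ord0 i) (x ord0 i)].
  by apply: (@measurable_box _ _ (fun i => A (lift ord0 i))) => i; exact: mA.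
rewrite -product_measure1E//.
congr product_measure1; apply/seteqP; split => [[a v] /= xA|[a v] /= [Aa Av] i].
  split; first by have := xA ord0; rewrite cons_rV0.
  by move=> i; have := xA (lift ord0 i); rewrite cons_rVS.
by case: (unliftP ord0 i) => [j ->|->]; rewrite ?cons_rVS ?cons_rV0.
Qed.

Section fractional_p_Laplacian.
Context (R : realType) (N : nat).
Implicit Types (D : set 'rV[R]_N) (u q phi : 'rV[R]_N -> R) (s p a : R).

Local Notation leb := (lebesgue_rV R N).

(* The canonical norm on 'rV[R]_N is the sup norm, hence this definition. *)
Definition enorm (x : 'rV[R]_N) : R := Num.sqrt (\sum_i x ord0 i ^+ 2).

(* Since leb is defined on Borel sets only, measurability with respect to its
   completion is phrased as a.e. equality with a Borel function. The integral of
   the library (a supremum over Borel simple functions) takes the expected value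
   on such functions. *)
Definition lebesgue_measurable D u :=
  exists2 g : 'rV[R]_N -> R, measurable_fun setT g & ae_eq leb D u g.

Definition in_Lp D (p : \bar R) u :=
  lebesgue_measurable D u /\ finite_norm leb p (u \_ D).

Definition in_Wsp s p u :=
  in_Lp setT p%:E u /\
  (\int[leb]_x \int[leb]_y
    (`|u x - u y| `^ p / enorm (x - y) `^ (N%:R + s * p))%:E < +oo)%E.

Definition in_Wsp0 s p D u :=
  in_Wsp s p u /\ {ae leb, forall x, ~ D x -> u x = 0}.

(* |a|^(p-2) a, which is 0 at a = 0 because of the factor a. *)
Definition signed_pow p a : R := `|a| `^ (p - 2) * a.

Definition weak_solution s p D q u :=
  forall phi, in_Wsp0 s p D phi -> (forall x, 0 <= phi x) ->
    compact (closure [set x | phi x != 0]) ->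
  (\int[leb]_x \int[leb]_y
     (signed_pow p (u x - u y) * (phi x - phi y)
        / enorm (x - y) `^ (N%:R + s * p))%:E
   + \int[leb]_(x in D) (q x * signed_pow p (u x) * phi x)%:E = 0)%E.

Definition holder_loc (alpha : R) D u :=
  forall K : set 'rV[R]_N, compact K -> K `<=` D ->
  exists C : R, forall x y, K x -> K y ->
    `|u x - u y| <= C * enorm (x - y) `^ alpha.

Definition vanishes_at_infinity u :=
  forall e, 0 < e -> exists M : R, forall x, M < enorm x -> `|u x| < e.

End fractional_p_Laplacian.

Definition half_space (R : realType) (n : nat) : set 'rV[R]_n.+1 :=
  [set x | 0 < x ord0 ord0].
Arguments half_space : clear implicits.

(* Main.v *)
Require Import Defs.
From mathcomp Require Import all_boot all_order all_algebra.
From mathcomp Require Import all_classical all_reals all_analysis.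
From mathcomp Require Import measurable_realfun ring lra.

Set Implicit Arguments.
Unset Strict Implicit.
Unset Printing Implicit Defensive.

Import Order.TTheory GRing.Theory Num.Theory.
Import numFieldNormedType.Exports.

Local Open Scope classical_set_scope.
Local Open Scope ring_scope.

(** The fractional p-Laplacian plus a nonnegative potential is a monotone
    operator, so a weak solution that may be used as its own test function has
    zero energy. Here u itself is not admissible, its support being possibly
    unbounded, but for e > 0 the truncation phi = max(0, u - e) is: u tends to
    0 at infinity, so phi has compact support; phi is a normal contraction of u
    (a 1-Lipschitz function vanishing at 0, composed with u), so it inherits
    every Sobolev bound of u (lemma in_Wsp0_contraction).

    Testing with phi gives a sum of two terms equal to 0. As phi is a
    nondecreasing function of u, the factors u(x) - u(y) and phi(x) - phi(y)
    have the same sign and the integrand of the nonlocal term is nonnegative;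
    the potential term is nonnegative because q, u and phi are. Hence the
    nonlocal term vanishes.

    If u(x0) > 0 this is absurd for e = u(x0) / 2. By continuity u stays well
    above e on a small cube around x0, and by decay u is below e on a cube far
    away. For x in the first cube and y in the second one the nonlocal
    integrand is bounded below by a positive constant; both cubes have positive
    measure, so the double integral is positive (lemma
    iterated_integral_gt0). *)

(** * Integrals of nonnegative functions *)

(** The integral of a nonnegative function is a supremum over the simple
    functions below it, hence is monotone on nonnegative functions of any kind. This
    matters for integrands built from a function that only agrees almost
    everywhere with a Borel one. *)
Lemma le_integral_subset d (T : measurableType d) (R : realType)
    (mu : {measure set T -> \bar R}) (D E : set T) (f g : T -> \bar R) :
  D `<=` E -> (forall x, D x -> 0 <= f x)%E -> (forall x, E x -> 0 <= g x)%E ->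
  (forall x, D x -> f x <= g x)%E ->
  (\int[mu]_(x in D) f x <= \int[mu]_(x in E) g x)%E.
Proof.
move=> DE f0 g0 fg; rewrite !ge0_integralE//; apply: ereal_sup_le.
apply: image_subset => h /= hf x; apply: le_trans (hf x) _; rewrite /patch.
case: ifPn => [/set_mem Dx|_].
  by rewrite (mem_set (DE _ Dx)); exact: fg.
by case: ifPn => // /set_mem; exact: g0.
Qed.

(** The negative part of f is dominated by +oo times the indicator of a null
    set, and therefore has integral 0. *)
Lemma integral_ge0_ae d (T : measurableType d) (R : realType)
    (mu : {measure set T -> \bar R}) (D : set T) (f : T -> \bar R) :
  {ae mu, forall x, D x -> (0 <= f x)%E} -> (0 <= \int[mu]_(x in D) f x)%E.
Proof.
move=> [A [mA A0 fA]]; rewrite integralE.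
suff -> : (\int[mu]_(x in D) f^\- x = 0)%E by rewrite sube0; exact: integral_ge0.
apply/eqP; rewrite eq_le integral_ge0// andbT.
have <- : (\int[mu]_(x in A) cst +oo x = 0)%E by rewrite integral_cst// A0 mule0.
rewrite integral_mkcond [leRHS]integral_mkcond.
apply: le_integral_subset => // x _; rewrite /patch.
- by case: ifPn.
- by case: ifPn => //= _; exact: leey.
- case: ifPn => [/set_mem Dx|_]; last by case: ifPn => // _; exact: leey.
  case: ifPn => [_|/negP xA]; first exact: leey.
  rewrite funenegE ge_max lexx andbT leeNl oppe0.
  by apply: contrapT => fx; apply: xA; apply/mem_set/fA => /(_ Dx).
Qed.

Lemma iterated_integral_gt0 d (T : measurableType d) (R : realType)
    (mu : {measure set T -> \bar R}) (F : T -> T -> \bar R) (A B : set T)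
    (c : \bar R) :
  measurable A -> measurable B -> (0 < mu A)%E -> (0 < mu B)%E -> (0 < c)%E ->
  (forall x y, 0 <= F x y)%E -> (forall x y, A x -> B y -> c <= F x y)%E ->
  (0 < \int[mu]_x \int[mu]_y F x y)%E.
Proof.
move=> mA mB A0 B0 c0 F0 cF.
have cB0 : (0 < c * mu B)%E by exact: mule_gt0.
apply: (@lt_le_trans _ _ (\int[mu]_(x in A) cst (c * mu B) x)%E).
  by rewrite integral_cst// mule_gt0.
apply: le_integral_subset => //= [x _|x _|x Ax]; first exact: ltW.
  exact: integral_ge0.
rewrite -integral_cst//; apply: le_integral_subset => //= y.
  by move=> _; exact: ltW.
exact: cF.
Qed.

(** * The Euclidean norm *)

Section euclidean_norm.
Context (R : realType) (N : nat).
Implicit Type x : 'rV[R]_N.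

Lemma enorm_ge0 x : 0 <= enorm x.
Proof. exact: sqrtr_ge0. Qed.

Lemma ler_coord_enorm x i : `|x ord0 i| <= enorm x.
Proof.
rewrite -sqrtr_sqr ler_wsqrtr// (bigD1 i)//= lerDl.
by apply: sumr_ge0 => j _; exact: sqr_ge0.
Qed.

Lemma enorm_gt0 x : x != 0 -> 0 < enorm x.
Proof.
move=> x0; rewrite lt_neqAle enorm_ge0 andbT; apply: contra_neqN x0 => x0.
apply/rowP => i; apply/eqP; rewrite mxE -normr_le0.
by rewrite (le_trans (ler_coord_enorm x i))// -(eqP x0).
Qed.

Lemma enorm_le x (C : R) : (forall i, `|x ord0 i| <= C) ->
  enorm x <= Num.sqrt (\sum_(i < N) C ^+ 2).
Proof.
move=> xC; apply: ler_wsqrtr; apply: ler_sum => i _.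
by rewrite -real_normK ?num_real// lerXn2r ?nnegrE// (le_trans _ (xC i)).
Qed.

Lemma compact_closure_enorm_le (A : set 'rV[R]_N) (M : R) :
  (forall x, A x -> enorm x <= M) -> compact (closure A).
Proof.
move=> AM; pose K := [set x : 'rV[R]_N | forall i, `[- M, M]%classic (x ord0 i)].
have cK : compact K.
  by apply: (@rV_compact R N (fun=> `[- M, M]%classic)) => i; exact: segment_compact.
apply: (subclosed_compact _ cK); first exact: closed_closure.
have /closure_id -> : closed K.
  by apply: (compact_closed _ cK); exact: norm_hausdorff.
apply: closureS => x Ax i /=; rewrite in_itv/= -ler_norml.
exact: le_trans (ler_coord_enorm x i) (AM _ Ax).
Qed.

End euclidean_norm.

(** * Truncation from below *)

Section truncation.
Context (R : realType).
Implicit Types e a b p : R.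

Definition excess e a : R := Num.max 0 (a - e).

Lemma excess_ge0 e a : 0 <= excess e a.
Proof. by rewrite le_max lexx. Qed.

Lemma excess_eq0 e a : a <= e -> excess e a = 0.
Proof. by move=> ae; apply/max_idPl; rewrite subr_le0. Qed.

Lemma excessE e a : e <= a -> excess e a = a - e.
Proof. by move=> ea; apply/max_idPr; rewrite subr_ge0. Qed.

Lemma le_excess e : {homo excess e : a b / a <= b}.
Proof. by move=> a b ab; rewrite le_max2// lerB. Qed.

Lemma excess_lipschitz e a b : `|excess e a - excess e b| <= `|a - b|.
Proof.
wlog ab : a b / b <= a.
  move=> H; have [|/ltW ba] := leP b a; first exact: H.
  by rewrite distrC [leRHS]distrC; exact: H.
rewrite !ger0_norm ?subr_ge0 ?le_excess//.
have [be|/ltW eb] := leP b e; last by rewrite !excessE ?(le_trans eb)//; lra.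
rewrite (excess_eq0 be) subr0; have [ae|/ltW ea] := leP a e.
  by rewrite excess_eq0// subr_ge0.
by rewrite excessE//; lra.
Qed.

Lemma measurable_excess e :
  measurable_fun setT (excess e : measurableTypeR R -> measurableTypeR R).
Proof. by apply: measurable_maxr => //; exact: measurable_funB. Qed.

(** The monotonicity of the p-Laplacian: b will be the increment of a
    nondecreasing function along the increment a. *)
Lemma signed_powM_ge0 p a b : 0 <= a * b -> 0 <= signed_pow p a * b.
Proof. by move=> ab; rewrite /signed_pow -mulrA mulr_ge0// powR_ge0. Qed.

Lemma signed_pow_gt0E p a : 0 < a -> signed_pow p a = a `^ (p - 1).
Proof.
move=> a0; rewrite /signed_pow gtr0_norm// -[X in _ * X]powRr1 ?ltW//.
rewrite -powRD; last by apply/implyP => _; rewrite gt_eqF.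
by rewrite -addrA; congr (a `^ (p + _)); ring.
Qed.

End truncation.

(** * Testing a weak solution with its truncation *)

Section nonexistence.
Context (R : realType) (n : nat).
Local Notation N := n.+1.
Local Notation leb := (lebesgue_rV R N).
Implicit Types (D : set 'rV[R]_N) (q u phi : 'rV[R]_N -> R) (s p r : R).

(** Normal contractions operate on the Sobolev space: they diminish both |u| and
    the increments of u, and they send 0 to 0. *)
Lemma in_Wsp0_contraction s p D u (h : R -> R) : 0 <= p ->
  measurable_fun setT (h : measurableTypeR R -> measurableTypeR R) ->
  h 0 = 0 -> (forall a b, `|h a - h b| <= `|a - b|) ->
  in_Wsp0 s p D u -> in_Wsp0 s p D (h \o u).
Proof.
move=> p_ge0 mh h0 hlip [[[[g mg ug] uLp] uW] uD].
have hle a : `|h a| <= `|a| by have := hlip a 0; rewrite h0 !subr0.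
split; last by apply: filterS uD => x ux Dx; rewrite /= ux.
split; first split.
- exists (h \o g); first exact: measurableT_comp mh mg.
  by apply: filterS ug => x ux _; rewrite /= ux.
- apply: le_lt_trans uLp; rewrite unlock /=.
  apply: gt0_ler_poweR; rewrite ?invr_ge0//.
  + by rewrite in_itv/= leey andbT; apply: integral_ge0 => x _; rewrite lee_fin powR_ge0.
  + by rewrite in_itv/= leey andbT; apply: integral_ge0 => x _; rewrite lee_fin powR_ge0.
  apply: le_integral_subset => // x _; rewrite ?lee_fin ?powR_ge0.
  by rewrite !patch_setT/= ge0_ler_powR ?nnegrE.
- apply: le_lt_trans uW.
  apply: le_integral_subset => // x _.
  + by apply: integral_ge0 => y _; rewrite lee_fin divr_ge0 ?powR_ge0.
  + by apply: integral_ge0 => y _; rewrite lee_fin divr_ge0 ?powR_ge0.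
  apply: le_integral_subset => // y _; rewrite lee_fin.
  + by rewrite divr_ge0 ?powR_ge0.
  + by rewrite divr_ge0 ?powR_ge0.
  + rewrite ler_wpM2r ?invr_ge0 ?powR_ge0// ge0_ler_powR ?nnegrE//.
    exact: hlip.
Qed.

Definition cube (c : 'rV[R]_N) r : set 'rV[R]_N :=
  [set x | forall i, ball (c ord0 i : R) r (x ord0 i)].

Lemma measurable_cube c r : measurable (cube c r).
Proof.
apply: (@measurable_box R N (fun i => ball (c ord0 i : R) r)) => i.
exact: measurable_ball.
Qed.

Lemma lebesgue_cube_gt0 c r : 0 < r -> (0 < leb (cube c r))%E.
Proof.
move=> r0; rewrite (@lebesgue_rV_box R N (fun i => ball (c ord0 i : R) r)); last first.
  by move=> i; exact: measurable_ball.
apply: (big_ind (fun x : \bar R => 0 < x)%E) => // [|i _]; first exact: mule_gt0.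
by rewrite lebesgue_measure_ball ?ltW// lte_fin pmulrn_lgt0.
Qed.

(** This bounds the singular kernel from below on a product of two cubes. *)
Lemma cube_dist c1 c2 r1 r2 x y : cube c1 r1 x -> cube c2 r2 y ->
  enorm (x - y) <=
  Num.sqrt (\sum_(i < N) (r1 + enorm (c1 - c2) + r2) ^+ 2).
Proof.
move=> xc yc; apply: enorm_le => i; rewrite !mxE.
have -> : x ord0 i - y ord0 i =
    - (c1 ord0 i - x ord0 i) + ((c1 - c2) ord0 i) + (c2 ord0 i - y ord0 i).
  by rewrite !mxE; ring.
apply: (le_trans (ler_normD _ _)); apply: lerD; last exact/ltW/yc.
apply: (le_trans (ler_normD _ _)); rewrite normrN; apply: lerD.
  exact/ltW/xc.
exact: ler_coord_enorm.
Qed.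

(** If u took a positive value, the nonlocal energy of u against its truncation
    at half of that value would be both zero and positive. *)
Lemma weak_solution_eq0 s p D q u : 0 <= s -> 1 < p ->
  {ae leb, forall x, D x -> 0 <= q x} ->
  in_Wsp0 s p D u -> (forall x, 0 <= u x) -> continuous u ->
  weak_solution s p D q u -> vanishes_at_infinity u ->
  forall x, u x = 0.
Proof.
move=> s0 p1 q0 uW u0 ucont usol ulim x0; apply/eqP.
apply: contrapT => /negP ux0; have {}ux0 : 0 < u x0 by rewrite lt_neqAle eq_sym ux0 u0.
(* The truncation level is 2 * d = u x0 / 2; the value 3 * d separates the
   region near x0 from that level by the gap d. *)
pose d := u x0 / 4; have d0 : 0 < d by rewrite divr_gt0.
have [M uM] := ulim (2 * d) ltac:(by rewrite mulr_gt0).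
have uM' x : M < enorm x -> u x < 2 * d.
  by move=> /uM; rewrite ger0_norm.
pose phi := excess (2 * d) \o u.
have phiW : in_Wsp0 s p D phi.
  apply: in_Wsp0_contraction uW; [lra|exact: measurable_excess| |].
    by rewrite excess_eq0// mulr_ge0// ltW.
  exact: excess_lipschitz.
have phi_supp : compact (closure [set x | phi x != 0]).
  apply: (@compact_closure_enorm_le _ _ _ M) => x /= phix.
  rewrite leNgt; apply: contra phix => /uM' ux.
  by rewrite /phi /= excess_eq0// ltW.
pose F x y := (signed_pow p (u x - u y) * (phi x - phi y)
        / enorm (x - y) `^ (N%:R + s * p))%:E.
have F0 x y : (0 <= F x y)%E.
  rewrite lee_fin divr_ge0 ?powR_ge0//; apply: signed_powM_ge0.
  have [xy|/ltW xy] := leP (u x) (u y).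
    by rewrite mulr_le0 ?subr_le0// le_excess.
  by rewrite mulr_ge0 ?subr_ge0// le_excess.
have I1 : (0 <= \int[leb]_x \int[leb]_y F x y)%E.
  by apply: integral_ge0 => x _; apply: integral_ge0.
have I2 : (0 <= \int[leb]_(x in D) (q x * signed_pow p (u x) * phi x)%:E)%E.
  apply: integral_ge0_ae; apply: filterS q0 => x qx Dx.
  by rewrite lee_fin !mulr_ge0 ?qx ?powR_ge0// excess_ge0.
have /eqP := usol phi phiW (fun x => excess_ge0 _ _) phi_supp.
rewrite padde_eq0// => /andP[/eqP energy0 _].
have [r r0 ur] : exists2 r, 0 < r & forall x, cube x0 r x -> 3 * d < u x.
  have /nbhs_ballP[r r0 ur] : \forall x \near x0, 3 * d < u x.
    by apply: (cvgr_gt _ (ucont x0)); rewrite /d; lra.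
  exists r => // x xr; apply: ur; split => // i j; rewrite (ord1 i); exact: xr.
(* The cube of radius 1 around c lies in the region where u < 2 * d, because the
   first coordinate of its points exceeds M. *)
pose c : 'rV[R]_N := const_mx (`|M| + 1).
have uc y : cube c 1 y -> u y < 2 * d.
  move=> /(_ ord0); rewrite /ball/= mxE => yc; apply: uM'.
  apply: lt_le_trans (ler_coord_enorm y ord0).
  have := ler_norm M; have := ler_norm (y ord0 ord0).
  by move: yc; rewrite ltr_norml => /andP[_]; lra.
pose K := 1 + Num.sqrt (\sum_(i < N) (r + enorm (x0 - c) + 1) ^+ 2).
have K0 : 0 < K by rewrite ltr_pwDl// sqrtr_ge0.
suff : (0 < \int[leb]_x \int[leb]_y F x y)%E by rewrite energy0 ltxx.
apply: (@iterated_integral_gt0 _ _ _ leb F (cube x0 r) (cube c 1)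
  (d `^ (p - 1) * d / K `^ (N%:R + s * p))%:E).
- exact: measurable_cube.
- exact: measurable_cube.
- exact: lebesgue_cube_gt0.
- exact: lebesgue_cube_gt0.
- by rewrite lte_fin divr_gt0 ?mulr_gt0 ?powR_gt0.
- exact: F0.
move=> x y xr yc; have ux := ur _ xr; have uy := uc _ yc.
have duxy : d <= u x - u y by lra.
have dphi : d <= phi x - phi y.
  by rewrite /phi/= (excess_eq0 (ltW uy)) excessE; lra.
have exy : 0 < enorm (x - y).
  apply: enorm_gt0; rewrite subr_eq0; apply: contraTneq duxy => ->.
  by rewrite subrr -ltNge.
rewrite lee_fin; apply: ler_pM; rewrite ?invr_ge0 ?powR_ge0//.
- by rewrite mulr_ge0 ?powR_ge0// ltW.
- apply: ler_pM => //; [exact: powR_ge0|exact: ltW|].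
  rewrite signed_pow_gt0E; last exact: lt_le_trans duxy.
  by rewrite ge0_ler_powR ?nnegrE//; lra.
- rewrite lef_pV2 ?posrE ?powR_gt0// ge0_ler_powR ?nnegrE ?(ltW exy) ?(ltW K0)//.
    by rewrite addr_ge0// mulr_ge0//; lra.
  by rewrite (le_trans (cube_dist xr yc))// /K; lra.
Qed.

End nonexistence.

(* The dimension N >= 1 is n.+1. *)
Theorem theorem1p4 (R : realType) (n : nat) (s p : R)
    (q u : 'rV[R]_n.+1 -> R)
    (s01 : 0 < s < 1) (p1 : 1 < p)
    (qLoo : in_Lp (half_space R n) +oo%E q)
    (q0 : {ae lebesgue_rV R n.+1, forall x, half_space R n x -> 0 <= q x})
    (uW : in_Wsp0 s p (half_space R n) u)
    (uLoo : in_Lp (half_space R n) +oo%E u)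
    (u0 : forall x, 0 <= u x)
    (ucont : continuous u)
    (usol : weak_solution s p (half_space R n) q u)
    (ulim : vanishes_at_infinity u)
    (qincr : forall x t, half_space R n x -> 0 <= t ->
      q x <= q (x + t *: delta_mx 0 0))
    (cases : ((1 - s)^-1 < p <= 2) \/
      (2 <= p /\ exists alpha : R, [/\ 0 < alpha <= 1,
        holder_loc alpha (half_space R n) u &
        s * p - 1 < alpha * (p - 2)])) :
  forall x, u x = 0.
Proof.
have /andP[s0 _] := s01.
exact: (weak_solution_eq0 (ltW s0) p1 q0 uW u0 ucont usol ulim).
Qed.
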